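(* For every integer $n\geq 3$, the group $$M_{3^n}=\langle a,b \mid a^{3^{n-1}}=b^3=e,\ b^{-1}ab=a^{3^{n-2}+1}\rangle$$ is not a Schur group; that is, there exists an $S$-ring over $M_{3^n}$ which is not schurian.
   Context: Let $G$ be a finite group with identity $e$, and for $X\subseteq G$ write $\underline{X}=\sum_{x\in X}x\in\mathbb{Z}G$. A subring $\mathcal{A}$ of the integral group ring $\mathbb{Z}G$ is an $S$-ring over $G$ if there is a partition $\mathcal{S}(\mathcal{A})$ of $G$ (its basic sets) such that $\{e\}\in\mathcal{S}(\mathcal{A})$, $X\in\mathcal{S}(\mathcal{A})\Rightarrow X^{-1}\in\mathcal{S}(\mathcal{A})$, and $\mathcal{A}=\mathrm{Span}_{\mathbb{Z}}\{\underline{X}: X\in\mathcal{S}(\mathcal{A})\}$. Let $G_{right}=\{x\mapsto xg : g\in G\}\leq \mathrm{Sym}(G)$. For a permutation group $\Gamma$ with $G_{right}\leq\Gamma\leq\mathrm{Sym}(G)$, the module spanned by $\underline{X}$ for $X$ ranging over the orbits of the stabilizer $\Gamma_e$ on $G$ is an $S$-ring, denoted $\mathcal{A}(\Gamma,G)$. An $S$-ring $\mathcal{A}$ over $G$ is schurian if $\mathcal{A}=\mathcal{A}(\Gamma,G)$ for some such $\Gamma$. A finite group $G$ is a Schur group if every $S$-ring over $G$ is schurian. *)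

(* Defs.v *)
From mathcomp Require Import all_boot all_fingroup.
Set Implicit Arguments.
Unset Strict Implicit.
Unset Printing Implicit Defensive.
Local Open Scope group_scope.

(* The finite group G is the whole finGroupType gT.  Elements of the integral
   group ring ZG are not introduced explicitly; instead we use that, for
   X, Y subsets of G, the product X_ * Y_ in ZG equals
   \sum_{z in G} #|{(x,y) in X x Y | x*y = z}| z. *)

Definition prod_coef (gT : finGroupType) (X Y : {set gT}) (z : gT) : nat :=
  #|[set p : gT * gT | (p.1 \in X) && (p.2 \in Y) && (p.1 * p.2 == z)]|.

(* S is the set of basic sets of an S-ring over gT:
   - S is a partition of G,
   - {e} is a basic set,
   - closed under X |-> X^-1,
   - Span_Z {X_ : X in S} is a subring, i.e. closed under multiplication
     (it contains 1 = {e}_ and is an additive subgroup by construction);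
     since the basic sets partition G, X_ * Y_ lies in the span iff its
     coefficient function is constant on every basic set. *)
Definition is_Sring (gT : finGroupType) (S : {set {set gT}}) : Prop :=
  [/\ partition S [set: gT],
      [set 1] \in S,
      (forall X, X \in S -> X^-1 \in S) &
      (forall X Y Z, X \in S -> Y \in S -> Z \in S ->
         forall z z', z \in Z -> z' \in Z -> prod_coef X Y z = prod_coef X Y z')].

Definition rtrans (gT : finGroupType) (g : gT) : {perm gT} := perm (mulIg g).

Definition Gright (gT : finGroupType) : {set {perm gT}} :=
  [set rtrans g | g : gT].

Definition stab_orbits (gT : finGroupType) (Gam : {group {perm gT}}) : {set {set gT}} :=
  orbit 'P [set s in Gam | s 1 == 1] @: [set: gT].

(* An S-ring (given by its basic sets) is schurian iff it equals A(Gamma,G)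
   for some G_right <= Gamma <= Sym(G); two S-rings coincide iff their
   partitions into basic sets coincide. *)
Definition schurian (gT : finGroupType) (S : {set {set gT}}) : Prop :=
  exists Gam : {group {perm gT}}, Gright gT \subset Gam /\ S = stab_orbits Gam.

Definition Schur_group (gT : finGroupType) : Prop :=
  forall S : {set {set gT}}, is_Sring S -> schurian S.

(* Main.v *)
Require Import Defs.
From mathcomp Require Import all_boot all_order all_algebra all_fingroup.
From mathcomp Require Import all_solvable.
From mathcomp Require Import ring.
Set Implicit Arguments.
Unset Strict Implicit.
Unset Printing Implicit Defensive.
Import GRing.Theory Num.Theory.
Local Open Scope group_scope.

(** Write [c = a^(3^(n-2))], [C = <c>], [E = <c, b>] (elementary abelian of
order 9), [K_k = <b c^k>] for [k] mod 3 and [Z = <a^3>], which is central.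
Conjugation by [a] fixes [C] and permutes [K_0, K_1, K_2] cyclically, and
[X = a K_0 + K_0 a^-1] satisfies
  [X X = a^2 E + a^-2 E + 3 (K_0 + K_1)],  [C X = K_2 X = a E + a^-1 E].
Therefore the functions on [G/E] invariant under inversion, their restrictions
to [Z], and the indicators of [1], [K_2] and [X] span an [S]-ring.

If [n >= 4] this ring is not schurian.  Suppose a permutation [s] preserves all
the colours [v u^-1], fixes 1 and maps [b] to [b^-1].  It fixes every coset
[a^i E], and the colours [X] and [Z] force [s (a^i) = x_i a^i] with
[x_(i+3) x_i^-1] in [C] independent of [i].  Hence [x_N = 1] for
[N = 3^(n-2)], because 9 divides [N]; that is, [s c = c].  Following [c b]
through its [X]-neighbours then gives a contradiction.

If [n = 3] the last step fails, but the basic sets of the ring can be merged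
into [1], [K_2 - 1], [C + X - 1] and the rest.  This is a distance-regular
antipodal cover of the complete graph on 9 vertices; no colour-preserving
permutation fixes 1 and maps [c] to [a], because only for the first of the
pairs [(1, c)], [(1, a)] do the third points of the triangles joining the two
corresponding [K_2]-cosets form a [K_2]-coset again. *)

(** * The group ring as integer functions under convolution *)

Section GroupRing.

Variable gT : finGroupType.
Implicit Types (f g h : gT -> int) (A B : {set gT}) (H K : {group gT}).

Definition conv f g (z : gT) : int := (\sum_x f x * g (x^-1 * z)%g)%R.
Definition ptmul f g (z : gT) : int := (f z * g z)%R.
Definition ind A (z : gT) : int := (z \in A)%:R%R.

(** A pair counted by [prod_coef] is determined by its first component. This ties the counting form
    of the S-ring axiom to convolution. *)
Lemma conv_ind X Y z : conv (ind X) (ind Y) z = (prod_coef X Y z)%:R%R.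
Proof.
have -> : prod_coef X Y z = #|[set x in X | x^-1 * z \in Y]|.
  rewrite /prod_coef -[RHS](card_imset _ (f := fun x => (x, x^-1 * z))); last first.
    by move=> x y [].
  apply: eq_card => -[x y]; rewrite !inE /=; apply/andP/imsetP.
    case=> /andP[Xx Yy] /eqP <-; exists x; rewrite ?inE ?Xx mulKg //.
  by case=> u; rewrite inE => /andP[Xu Yu] [-> ->]; rewrite Xu Yu mulKVg.
rewrite -sum1_card natr_sum big_mkcond /=; apply: eq_bigr => x _.
by rewrite /ind inE; case: (x \in X); case: (_ \in Y); rewrite ?mulr0 ?mul0r ?mulr1.
Qed.

(** The generators may form an infinite family, such as all functions on a quotient, so the span is
    built inductively; [Zspan_ext] lets functions be compared pointwise. *)
Inductive Zspan (G : (gT -> int) -> Prop) : (gT -> int) -> Prop :=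
| Zspan_gen f : G f -> Zspan G f
| Zspan_add f g : Zspan G f -> Zspan G g -> Zspan G (fun x => f x + g x)%R
| Zspan_scale k f : Zspan G f -> Zspan G (fun x => k * f x)%R
| Zspan_ext f g : Zspan G f -> f =1 g -> Zspan G g.

Lemma Zspan_bilinear (op : (gT -> int) -> (gT -> int) -> gT -> int) G :
    (forall f f' g g', f =1 f' -> g =1 g' -> op f g =1 op f' g') ->
    (forall f g h, op (fun x => f x + g x)%R h =1 fun x => (op f h x + op g h x)%R) ->
    (forall f g h, op h (fun x => f x + g x)%R =1 fun x => (op h f x + op h g x)%R) ->
    (forall k f h, op (fun x => k * f x)%R h =1 fun x => (k * op f h x)%R) ->
    (forall k f h, op h (fun x => k * f x)%R =1 fun x => (k * op h f x)%R) ->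
    (forall f g, G f -> G g -> Zspan G (op f g)) ->
  forall f g, Zspan G f -> Zspan G g -> Zspan G (op f g).
Proof.
move=> opE opDl opDr opZl opZr Gop f g sf; elim: sf g => {f}.
- move=> f Gf g; elim=> {g} [g Gg|g h _ IHg _ IHh|k g _ IHg|g h _ IHg gh].
  + exact: Gop.
  + by apply: Zspan_ext (Zspan_add IHg IHh) _ => x; rewrite opDr.
  + by apply: Zspan_ext (Zspan_scale k IHg) _ => x; rewrite opZr.
  + by apply: Zspan_ext IHg _; apply: opE.
- move=> f g _ IHf _ IHg h sh.
  by apply: Zspan_ext (Zspan_add (IHf _ sh) (IHg _ sh)) _ => x; rewrite opDl.
- move=> k f _ IHf h sh.
  by apply: Zspan_ext (Zspan_scale k (IHf _ sh)) _ => x; rewrite opZl.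
- by move=> f g _ IHf fg h sh; apply: Zspan_ext (IHf _ sh) _; apply: opE.
Qed.

Lemma convDl f g h : conv (fun x => f x + g x)%R h =1 fun z => (conv f h z + conv g h z)%R.
Proof. by move=> z; rewrite /conv -big_split; apply: eq_bigr => x _; rewrite mulrDl. Qed.

Lemma convDr f g h : conv h (fun x => f x + g x)%R =1 fun z => (conv h f z + conv h g z)%R.
Proof. by move=> z; rewrite /conv -big_split; apply: eq_bigr => x _; rewrite mulrDr. Qed.

Lemma eq_conv f f' g g' : f =1 f' -> g =1 g' -> conv f g =1 conv f' g'.
Proof. by move=> ff gg z; apply: eq_bigr => x _; rewrite ff gg. Qed.

Lemma Zspan_conv G : (forall f g, G f -> G g -> Zspan G (conv f g)) ->
  forall f g, Zspan G f -> Zspan G g -> Zspan G (conv f g).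
Proof.
apply: Zspan_bilinear => [|||k f h z|k f h z].
- exact: eq_conv.
- exact: convDl.
- exact: convDr.
- by rewrite /conv big_distrr; apply: eq_bigr => x _; rewrite -mulrA.
- by rewrite /conv big_distrr; apply: eq_bigr => x _; rewrite mulrCA.
Qed.

Lemma Zspan_ptmul G : (forall f g, G f -> G g -> Zspan G (ptmul f g)) ->
  forall f g, Zspan G f -> Zspan G g -> Zspan G (ptmul f g).
Proof.
apply: Zspan_bilinear => [f f' g g' ff gg|f g h|f g h|k f h|k f h] z.
- by rewrite /ptmul ff gg.
- exact: mulrDl.
- exact: mulrDr.
- by rewrite /ptmul mulrA.
- by rewrite /ptmul mulrCA.
Qed.

(** Inversion reverses products in the group ring and fixes both factors. *)
Lemma conv_sym f g : (forall x, f x^-1 = f x) -> (forall x, g x^-1 = g x) ->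
  forall z, conv f g z^-1 = conv g f z.
Proof.
move=> fV gV z; rewrite /conv (reindex_inj (mulgI z^-1)) /=.
apply: eq_bigr => x _; rewrite mulrC invMg invgK -mulgA mulgV mulg1 gV.
by rewrite -fV invMg invgK.
Qed.

Lemma conv1l f : conv (ind 1) f =1 f.
Proof.
move=> z; rewrite /conv (bigD1 1) //= big1 => [|x /negPf xn1].
  by rewrite /ind inE eqxx mul1r invg1 mul1g addr0.
by rewrite /ind inE xn1 mul0r.
Qed.

Lemma conv1r f : conv f (ind 1) =1 f.
Proof.
move=> z; rewrite /conv (bigD1 z) //= big1 => [|x /negPf xnz].
  by rewrite /ind mulVg group1 mulr1 addr0.
by rewrite /ind inE -eq_mulVg1 xnz mulr0.
Qed.

Lemma conv_cst f : conv f (fun=> 1%R) =1 fun=> (\sum_x f x)%R.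
Proof. by move=> z; apply: eq_bigr => x _; rewrite mulr1. Qed.

Lemma conv_cstl f : conv (fun=> 1%R) f =1 fun=> (\sum_x f x)%R.
Proof.
move=> z; rewrite [RHS](reindex_inj invg_inj) [RHS](reindex_inj (mulgI z^-1)) /=.
by apply: eq_bigr => x _; rewrite mul1r invMg invgK.
Qed.

Lemma ptmul_ind A B : ptmul (ind A) (ind B) =1 ind (A :&: B).
Proof. by move=> z; rewrite /ptmul /ind inE -natrM mulnb. Qed.

Lemma conv_indg H f z : conv (ind H) f z = (\sum_(x in H) f (x * z)%g)%R.
Proof.
rewrite /conv (reindex_inj invg_inj) /= [RHS]big_mkcond /=; apply: eq_bigr => x _.
by rewrite /ind groupV invgK; case: ifP => _; rewrite ?mul1r ?mul0r.
Qed.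

Lemma sum_ind_same H z : (\sum_(x in H) ind H (x * z)%g = #|H|%:R * ind H z)%R.
Proof.
rewrite (eq_bigr (fun _ => ind H z)) => [|x Hx].
  by rewrite sumr_const mulr_natl.
by rewrite /ind groupMl.
Qed.

(** Trivial intersection makes the factorization of each element of HK unique, so the product of the
    two indicators has only coefficients 0 and 1. *)
Lemma sum_ind_TI H K z : H :&: K = 1 ->
  (\sum_(x in H) ind K (x * z)%g = ind (H * K)%g z)%R.
Proof.
move=> tiHK; rewrite {2}/ind; case: mulsgP => [[h k Hh Kk ->]|notHK].
  rewrite (bigD1 h^-1) ?groupV //= mulKg /ind Kk big1 ?addr0 // => x /andP[Hx xh].
  rewrite mulgA groupMr //; case: (boolP (_ \in K)) => // Kxh.
  have: x * h \in H :&: K by rewrite inE groupM.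
  by rewrite tiHK inE -eq_invg_mul => /eqP /(canRL invgK) xh1; rewrite xh1 eqxx in xh.
rewrite big1 // => x Hx; rewrite /ind; case: (boolP (_ \in K)) => // Kxz.
by case: notHK; exists x^-1 (x * z); rewrite ?groupV ?mulKg.
Qed.

End GroupRing.

(** * S-rings given by colourings *)

Section Coloring.

Variables (gT : finGroupType) (T : eqType) (col : gT -> T).
Let S := preim_partition col [set: gT].

Lemma mem_color_class X : X \in S -> exists x, X = [set y | col y == col x].
Proof.
case/imsetP=> x _ ->; exists x.
by apply/setP=> y; rewrite !inE eq_sym.
Qed.

(** The span contains the indicators of all colour classes and consists of functions constant on
    them, so closure under convolution makes every product of two classes constant on classes. *)
Lemma Sring_of_Zspan (G : (gT -> int) -> Prop) :
    (forall f, G f -> forall x y, col x = col y -> f x = f y) ->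
    (forall s, Zspan G (fun y => (col y == s)%:R%R)) ->
    (forall f g, G f -> G g -> Zspan G (conv f g)) ->
    (forall x, col x^-1 = col x) -> (forall x, col x = col 1 -> x = 1) ->
  is_Sring S.
Proof.
move=> Gcol Gind Gconv colV col1; split=> [||X|X Y Z].
- exact: preim_partitionP.
- apply/imsetP; exists 1 => //; apply/setP=> x; rewrite !inE /=.
  by apply/eqP/eqP=> [->|/esym/col1].
- case/imsetP=> x _ ->; apply/imsetP; exists x => //; apply/setP=> y.
  by rewrite !inE /= colV.
- move=> /mem_color_class[x ->] /mem_color_class[y ->] /mem_color_class[t ->] z z'.
  rewrite !inE => /eqP zt /eqP z't.
  have const f : Zspan G f -> f z = f z'.
    elim=> {f} [f Gf|f g _ -> _ -> //|k f _ -> //|f g _ eqf fg].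
      by apply: Gcol => //; rewrite zt.
    by rewrite -!fg.
  have sind s : Zspan G (ind [set u | col u == s]).
    by apply: Zspan_ext (Gind s) _ => u; rewrite /ind inE.
  have := const _ (Zspan_conv Gconv (sind (col x)) (sind (col y))).
  rewrite !conv_ind => /eqP; rewrite eqr_nat; move/eqP; exact.
Qed.

(* Right translations carry the invariance of the basic sets under the point
stabilizer over to all arcs [(u, v)] of colour [v * u^-1]. *)
Lemma schurian_color : schurian S -> forall x y, col x = col y ->
  exists s : {perm gT}, [/\ s 1 = 1, s x = y &
    forall u v, col (s v * (s u)^-1) = col (v * u^-1)].
Proof.
case=> Gam [/subsetP sG defS] x y colxy.
have rG g : rtrans g \in Gam by apply: sG; apply: imset_f.
have class_x : [set z | col z == col x] \in S.
  by apply/imsetP; exists x => //; apply/setP=> z; rewrite !inE eq_sym.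
have orb u s : s \in Gam -> s 1 = 1 -> col (s u) = col u.
  move=> Gs s1.
  have: orbit 'P [set s in Gam | s 1 == 1] u \in S.
    by rewrite defS; apply: imset_f.
  case/mem_color_class=> w defO.
  have: u \in orbit 'P [set s in Gam | s 1 == 1] u.
    by apply/imsetP; exists 1; rewrite ?inE ?group1 ?perm1 //= /aperm ?perm1.
  have: s u \in orbit 'P [set s in Gam | s 1 == 1] u.
    by apply/imsetP; exists s; rewrite ?inE ?Gs ?s1 //=.
  by rewrite defO !inE => /eqP-> /eqP->.
move: class_x; rewrite defS => /imsetP[w _ defO].
have: x \in orbit 'P [set s in Gam | s 1 == 1] w by rewrite -defO inE.
have: y \in orbit 'P [set s in Gam | s 1 == 1] w by rewrite -defO inE colxy.
case/imsetP=> s; rewrite inE => /andP[Gs /eqP s1] sy.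
case/imsetP=> t; rewrite inE => /andP[Gt /eqP t1] tx.
(* Through the base point [w] of the orbit: [t^-1] takes [x] to [w], and [s] takes [w] to [y]. *)
have Gts : t^-1 * s \in Gam by rewrite groupM ?groupV.
exists (t^-1 * s); split.
- by rewrite permM -{1}t1 permK.
- by rewrite permM tx /= /aperm permK sy.
- move: (t^-1 * s) Gts => r Gr u v.
  (* Flanking [r] by translations gives a member of [Gam] that fixes 1 and maps v u^-1 to r(v)
     r(u)^-1. *)
  have := orb (v * u^-1) (rtrans u * r * rtrans (r u)^-1).
  rewrite !permM !permE mulgKV mul1g mulgV; apply => //.
  by rewrite !groupM.
Qed.

End Coloring.

Lemma Zspan_flag (gT : finGroupType) (G : (gT -> int) -> Prop) (A : {set gT}) b :
  Zspan G (fun=> 1%R) -> Zspan G (ind A) ->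
  Zspan G (fun y => ((y \in A) == b)%:R%R).
Proof.
move=> G1 GA; case: b.
  by apply: Zspan_ext GA _ => y; rewrite /ind; case: (y \in A).
apply: Zspan_ext (Zspan_add G1 (Zspan_scale (-1)%R GA)) _ => y.
by rewrite /ind; case: (y \in A).
Qed.

(** * Products in the group ring of [M_(3^n)] *)

Section ModularGroup.

(** [N] stands for 3^(n-2). The order 27 case later adds N = 3, the other case 9 | N. *)
Variables (gT : finGroupType) (a b : gT) (N : nat).
Hypotheses (oa : #[a] = (3 * N)%N) (ob : #[b] = 3) (N3 : 3 %| N).
Hypotheses (aJb : a ^ b = a ^+ N.+1) (notAb : b \notin <[a]>).
Hypothesis genab : forall x, exists i j, x = a ^+ i * b ^+ j.

Let c := a ^+ N.
Let C := <[c]>%G.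
Let Z := <[a ^+ 3]>%G.
(* [C], [K 0], [K 1] and [K 2] are the subgroups of order 3 of [E]; [K k] only
depends on [k] modulo 3. *)
Let K k := <[b * c ^+ k]>%G.
Let E := (C <*> <[b]>)%G.

(** * Central elements and the subgroups of order 3 of E *)

Let N_gt0 : 0 < N. Proof. by move: (order_gt0 a); rewrite oa muln_gt0. Qed.

Let oc : #[c] = 3.
Proof. by rewrite orderXdiv oa ?dvdn_mull // mulnK. Qed.

Let c3 : c ^+ 3 = 1. Proof. by rewrite -oc expg_order. Qed.

Let b3 : b ^+ 3 = 1. Proof. by rewrite -ob expg_order. Qed.

Let cN : c ^+ N = 1. Proof. by apply/eqP; rewrite -order_dvdn oc. Qed.

Let cent_c x : commute c x.
Proof.
have cb : commute c b.
  apply/commgP/conjg_fixP; rewrite conjXg aJb -expgM mulnC expgM -/c.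
  by rewrite expgS cN mulg1.
have [i [j ->]] := genab x.
by apply: commuteM; apply: commuteX => //; apply/commute_sym/commuteX.
Qed.

Let commuteXl k x : commute (c ^+ k) x.
Proof. exact/commute_sym/commuteX/commute_sym. Qed.

Let cent_z z x : z \in Z -> commute z x.
Proof.
case/cycleP=> k ->; apply/commute_sym/commuteX/commute_sym.
have zb : commute (a ^+ 3) b.
  apply/commgP/conjg_fixP; rewrite conjXg aJb -expgM mulnC expgM.
  by rewrite expgS -expgM -oa expg_order mulg1.
have [i [j ->]] := genab x.
by apply: commuteM; apply: commuteX => //; apply/commute_sym/commuteX.
Qed.

Let ZJ z x : z \in Z -> z ^ x = z.
Proof. by move=> Zz; apply/conjg_fixP/commgP/cent_z. Qed.

Let bJa : b ^ a = b * c^-1.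
Proof.
have ab : a * b = b * (a * c) by rewrite /c -expgS -aJb conjgE !mulgA mulgV mul1g.
apply: (mulgI a); rewrite conjgE !mulgA mulgV mul1g ab -!mulgA.
by rewrite mulgV mulg1.
Qed.

(** Since b^a = b c^-1 with c central, conjugation by a lowers the index by one. *)
Let KJ k : K k.+1 :^ a = K k.
Proof.
rewrite /K /= -cycleJ conjMg bJa conjXg; congr <[_]>.
have -> : c ^ a = c by apply/conjg_fixP/commgP.
by rewrite expgS -mulgA mulKg.
Qed.

Let KJV k : K k :^ a^-1 = K k.+1. Proof. by rewrite -KJ conjsgK. Qed.

Let K3 : K 3 = K 0. Proof. by rewrite /K c3. Qed.

Let defE : E = C * <[b]> :> {set gT}.
Proof.
rewrite /= cent_joinEr // cent_cycle cycle_subG.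
exact/cent1P/commute_sym/cent_c.
Qed.

Let CE : C \subset E. Proof. exact: joing_subl. Qed.
Let bE : b \in E. Proof. by rewrite -cycle_subG joing_subr. Qed.
Let cE : c \in E. Proof. by rewrite -cycle_subG. Qed.
Let KE k : K k \subset E.
Proof. by rewrite /K cycle_subG; apply: groupM; [exact: bE | apply: groupX; exact: cE]. Qed.

Let ZC z : z \in C -> z \in Z.
Proof.
move=> Cz; apply: (subsetP _ _ Cz); rewrite cycle_subG /c.
by case/dvdnP: N3 => k ->; rewrite mulnC expgM mem_cycle.
Qed.

Let notCb k : b * c ^+ k \notin C.
Proof.
rewrite groupMr; last by apply: groupX; apply: cycle_id.
apply/negP=> Cb; case/negP: notAb; apply: (subsetP _ _ Cb).
by rewrite cycle_subG mem_cycle.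
Qed.

Let oK k : #|K k| = 3.
Proof.
apply: nt_prime_order => //; last first.
  by apply: contraNneq (notCb k) => ->; apply: group1.
rewrite expgMn; last exact/commuteX/commute_sym/cent_c.
by rewrite b3 mul1g -expgM mulnC expgM c3 expg1n.
Qed.

Let abE : abelian E.
Proof.
rewrite /= defE abelianM !cycle_abelian cent_cycle cycle_subG.
exact/cent1P/commute_sym/cent_c.
Qed.

Let oE : #|E| = 9.
Proof.
rewrite /= defE TI_cardMg; first by rewrite -!orderE oc ob.
rewrite setIC prime_TIg -?orderE ?ob // cycle_subG.
by have := notCb 0; rewrite mulg1.
Qed.

Let E_prod (H L : {group gT}) : H \subset E -> L \subset E -> #|H| = 3 -> #|L| = 3 ->
  ~~ (H \subset L) -> H :&: L = 1 /\ H * L = E.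
Proof.
move=> sH sL oH oL nsHL; have tiHL : H :&: L = 1 by apply: prime_TIg; rewrite ?oH.
split=> //; apply/eqP; rewrite eqEcard mul_subG //=.
by rewrite oE TI_cardMg // oH oL.
Qed.

Let CK k : C :&: K k = 1 /\ C * K k = E.
Proof.
apply: E_prod (KE k) oc (oK k) _; first exact: CE.
apply/negP=> sCK; case/negP: (notCb k); suff -> : C = K k :> {set gT} by apply: cycle_id.
by apply/eqP; rewrite eqEcard sCK oK -[#|_|]/#[c] oc.
Qed.

Let KK k : K k.+1 :&: K k = 1 /\ K k.+1 * K k = E.
Proof.
apply: E_prod (KE _) (KE _) (oK _) (oK _) _; apply/negP; rewrite cycle_subG => Kk.
suff: c \in C :&: K k.
  by case: (CK k) => -> _ /set1gP c1; move: oc; rewrite c1 order1.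
rewrite inE cycle_id /= -(groupMl _ (cycle_id (b * c ^+ k))).
by rewrite -mulgA -expgSr.
Qed.

Let K20 : K 2 :&: K 0 = 1 /\ K 2 * K 0 = E.
Proof.
have [tiK prodK] := KK 2; rewrite -K3 setIC; split=> //.
by rewrite -invMG prodK invGid.
Qed.

(** The four subgroups of order 3 of an elementary abelian group of order 9 partition its
    nonidentity elements. *)
Let E_cover z : z \in E -> z != 1 ->
  (ind C z + ind (K 0) z + ind (K 1) z + ind (K 2) z = 1)%R.
Proof.
move=> Ez z1; have ti (A B : {group gT}) : A :&: B = 1 -> z \in A -> z \in B -> false.
  by move=> tiAB Az Bz; rewrite -(negPf z1) -in_set1 -[[set 1]]tiAB inE Az.
have Kmod k : b * c ^+ k \in K (k %% 3) by rewrite /K expg_mod // cycle_id.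
have: [|| z \in C, z \in K 0, z \in K 1 | z \in K 2].
  have inK k y : y \in K (k %% 3) -> [|| y \in C, y \in K 0, y \in K 1 | y \in K 2].
    have: k %% 3 < 3 by rewrite ltn_pmod.
    by case: (k %% 3) => [|[|[|]]] // _ ->; rewrite ?orbT.
  move: Ez; rewrite /= defE => /mulsgP[_ _ /cycleP[p ->] /cycleP[q ->] ->].
  rewrite -(expg_mod q b3).
  have: q %% 3 < 3 by rewrite ltn_pmod.
  case: (q %% 3) => [|[|[|]]] // _.
  - by rewrite mulg1 mem_cycle.
  - by rewrite expg1 (commuteXl p b); apply: (inK p); apply: Kmod.
  - apply: (inK (p * 2)%N); rewrite (commuteXl p (b ^+ 2)).
    (* Squaring b c^(2p) gives b^2 c^(4p), and c^4 = c. *)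
    have -> : b ^+ 2 * c ^+ p = (b * c ^+ (p * 2)) ^+ 2.
      rewrite expgMn; last exact/commute_sym/commuteXl.
      have e : (p * 2 * 2 = p + 3 * p)%N by rewrite -mulnA (mulnC 3) -mulnS.
      by rewrite -(expgM c) e expgD (expgM c 3) c3 expg1n mulg1.
    by apply: groupX; apply: Kmod.
have := ti _ _ (CK 0).1; have := ti _ _ (CK 1).1; have := ti _ _ (CK 2).1.
have := ti _ _ (KK 0).1; have := ti _ _ (KK 1).1; have := ti _ _ K20.1.
rewrite /ind; case: (z \in C); case: (z \in K 0); case: (z \in K 1);
  case: (z \in K 2) => // p1 p2 p3 p4 p5 p6 _;
  by [|case: (p1 isT isT)|case: (p2 isT isT)|case: (p3 isT isT)
      |case: (p4 isT isT)|case: (p5 isT isT)|case: (p6 isT isT)].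
Qed.

Let normE : E <| [set: gT].
Proof.
apply/andP; split; first exact: subsetT.
apply/subsetP=> x _; have [i [j ->]] := genab x.
apply: groupM; last by apply: groupX; apply: (subsetP (normG _)) bE.
apply: groupX; rewrite inE; apply/subsetP=> _ /imsetP[y + ->].
rewrite /= defE => /mulsgP[u _ Cu /cycleP[k ->] ->]; rewrite -defE conjMg.
apply: groupM; first by rewrite ZJ ?ZC // (subsetP CE).
by rewrite conjXg bJa; apply: groupX; apply: groupM bE (groupVr cE).
Qed.

(** [<[a]>] meets [<[b]>] trivially, so a power of a lying in C<b> is already a power of c. *)
Let a_E i : (a ^+ i \in E) = (N %| i).
Proof.
apply/idP/idP=> [|/dvdnP[k ->]]; last by rewrite mulnC expgM; apply: groupX; exact: cE.
rewrite /= defE => /mulsgP[_ _ /cycleP[p ->] /cycleP[q ->] def_ai].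
have bq1 : b ^+ q = 1.
  have tiBA : <[b]> :&: <[a]> = 1 by rewrite prime_TIg ?cycle_subG // -orderE ob.
  apply/set1gP; rewrite -tiBA inE mem_cycle /= -(mulKg (c ^+ p) (b ^+ q)) -def_ai.
  by rewrite groupM ?groupV ?groupX ?mem_cycle ?cycle_id.
move: def_ai; rewrite bq1 mulg1 -expgM => /eqP; rewrite eq_expg_mod_order oa => /eqP e.
have : i %% N = (N * p) %% N.
  by rewrite -(modn_dvdm i (dvdn_mull 3 (dvdnn N))) e modn_dvdm ?dvdn_mull.
by rewrite modnMr => /eqP.
Qed.

Let Z_E z : z \in Z -> z \in E -> z \in C.
Proof.
case/cycleP=> k ->; rewrite -expgM a_E => /dvdnP[j ->].
by rewrite mulnC expgM mem_cycle.
Qed.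

(* [X] is the union of [a *: K 0] and of its inverse. *)
Let X : {set gT} := [set x | (a^-1 * x \in K 0) || (x * a \in K 0)].

Let decE x : exists i, exists2 u, u \in E & x = a ^+ i * u.
Proof.
have [i [j ->]] := genab x; exists i; exists (b ^+ j) => //.
by apply: groupX; exact: bE.
Qed.

Let EJ u x : (u ^ x \in E) = (u \in E).
Proof. by apply: memJ_norm; apply: (subsetP (normal_norm normE)). Qed.

Let ind_X x : ind X x = (ind (K 0) (a^-1 * x)%g + ind (K 0) (x * a)%g)%R.
Proof.
rewrite /ind inE; case: (boolP (a^-1 * x \in K 0)) => /= Kax; last by rewrite add0r.
case: (boolP (x * a \in K 0)) => /= Kxa; last by rewrite addr0.
exfalso.
(* The two halves of [X] are disjoint: a common element would put a^2 in E, so that N, and with it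
   3, would divide 2. *)
suff : a ^+ 2 \in E by rewrite a_E => /(dvdn_trans N3).
have Ex : a^-1 * x \in E by apply: (subsetP (KE 0)).
rewrite -(mulgK ((a^-1 * x) ^ a) (a ^+ 2)); apply: groupM; last first.
  by rewrite groupV EJ.
rewrite (_ : _ * _ = x * a); first exact: (subsetP (KE 0)).
by rewrite expgS expg1 conjgE !mulgA mulgK mulgV mul1g.
Qed.

Let X_sym x : (x^-1 \in X) = (x \in X).
Proof. by rewrite !inE orbC -(groupV _ (x^-1 * a)) -(groupV _ (a^-1 * x^-1)) !invMg !invgK. Qed.

(* Functions on [G / E], i.e. [E]-invariant ones, that are moreover invariant
under inversion. *)
Definition unif (w : gT -> int) :=
  (forall x u, u \in E -> w (x * u) = w x) /\ (forall x, w x^-1 = w x).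

Let unif_l w x u : unif w -> u \in E -> w (u * x) = w x.
Proof. by case=> wE _ Eu; rewrite (conjgC u x) wE ?EJ. Qed.

(** G/E is cyclic, generated by the image of a, hence commutative. *)
Let unif_comm w x y : unif w -> w (x * y) = w (y * x).
Proof.
move=> [wE _].
suff ha u v i k : u \in E -> v \in E -> w (a ^+ i * u * (a ^+ k * v)) = w (a ^+ (i + k)).
  case: (decE x) => i [u Eu ->]; case: (decE y) => k [v Ev ->].
  by rewrite !ha // addnC.
by move=> Eu Ev; rewrite mulgA wE // -mulgA (conjgC u) mulgA wE ?EJ // expgD.
Qed.

Let sumJ (H : {set gT}) x (F : gT -> int) :
  (\sum_(l in H) F (l ^ x)%g = \sum_(l in H :^ x) F l)%R.
Proof.
rewrite [RHS](reindex_inj (conjg_inj x)) /=; apply: eq_bigl => l.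
by rewrite memJ_conjg.
Qed.

Let w1 (x : gT) : int := (ind E (a^-1 * x)%g + ind E (x * a)%g)%R.
Let w2 (x : gT) : int := (ind E (a ^- 2 * x)%g + ind E (x * a ^+ 2)%g)%R.

Let unif_E g : unif (fun x => ind E (g^-1 * x)%g + ind E (x * g)%g)%R.
Proof.
split=> [x u Eu|x].
  by rewrite /ind mulgA groupMr // -(mulgA x) (conjgC u) mulgA (groupMr (x * g)) ?EJ.
rewrite addrC /ind -(groupV E (x^-1 * g)) -(groupV E (g^-1 * x^-1)).
by rewrite !invMg !invgK.
Qed.

(** C is central, so C a K_0 = a C K_0 = a E, and C K_0 a^-1 = E a^-1. *)
Let conv_CX : conv (ind C) (ind X) =1 w1.
Proof.
move=> z; rewrite conv_indg (eq_bigr _ (fun l _ => ind_X (l * z))) big_split /=.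
congr (_ + _)%R.
  rewrite -(CK 0).2 -(sum_ind_TI _ (CK 0).1).
  apply: eq_bigr => l /ZC Zl; congr ind.
  by rewrite mulgA -(cent_z _ Zl) mulgA.
rewrite /w1 -(CK 0).2 -(sum_ind_TI _ (CK 0).1).
by apply: eq_bigr => l _; rewrite mulgA.
Qed.

(** Moving a to the left turns K_2 into K_1: K_2 a K_0 = a K_1 K_0 = a E, while K_2 K_0 a^-1 = E
    a^-1. *)
Let conv_KX : conv (ind (K 2)) (ind X) =1 w1.
Proof.
move=> z; rewrite conv_indg (eq_bigr _ (fun l _ => ind_X (l * z))) big_split /=.
congr (_ + _)%R.
  rewrite /w1 -(KK 0).2 -(sum_ind_TI _ (KK 0).1) -KJ -sumJ.
  by apply: eq_bigr => l _; congr ind; rewrite conjgE !mulgA mulgK.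
rewrite /w1 -K20.2 -(sum_ind_TI _ K20.1).
by apply: eq_bigr => l _; rewrite mulgA.
Qed.

(* The parenthesis is the indicator of [K 0] plus that of [K 1]. *)
Let conv_XX z : conv (ind X) (ind X) z =
  (w2 z + 3 * (ind E z - ind C z - ind (K 2) z + 3 * ind 1%g z))%R.
Proof.
have conv_X g : conv (ind X) g z =
    (\sum_(l in K 0) g (l * (a^-1 * z))%g + \sum_(l in K 0) g (a * (l * z))%g)%R.
  rewrite /conv (eq_bigr _ (fun x _ => congr1 (fun t => t * _)%R (ind_X x))).
  rewrite (eq_bigr _ (fun x _ => mulrDl _ _ _)) big_split /=.
  congr (_ + _)%R.
    transitivity (conv (ind (K 0)) g (a^-1 * z)); last exact: conv_indg.
    rewrite /conv (reindex_inj (mulgI a)) /=; apply: eq_bigr => x _.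
    by rewrite mulKg invMg mulgA.
  transitivity (conv (ind (K 0)) (fun y => g (a * y)%g) z); last exact: conv_indg.
  rewrite /conv (reindex_inj (mulIg a^-1)) /=; apply: eq_bigr => x _.
  by rewrite mulgKV invMg invgK mulgA.
(* The four products of halves of X, in order: a K_0 a K_0 = a^2 K_2 K_0 = a^2 E, a K_0 K_0 a^-1 = 3
   K_1, K_0 a^-1 a K_0 = 3 K_0, and K_0 a^-1 K_0 a^-1 = K_0 K_1 a^-2 = E a^-2. *)
rewrite conv_X !(eq_bigr _ (fun l _ => ind_X _)) !big_split /=.
have -> : (\sum_(l in K 0) ind (K 0) (a^-1 * (l * (a^-1 * z)))%g = ind E (a ^- 2 * z)%g)%R.
  rewrite -K20.2 -(sum_ind_TI _ K20.1) -(KJ 2) K3 -sumJ.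
  by apply: eq_bigr => l _; congr ind; rewrite conjgE expgS expg1 invMg !mulgA mulgK.
have -> : (\sum_(l in K 0) ind (K 0) (l * (a^-1 * z) * a)%g = 3 * ind (K 1) z)%R.
  rewrite -[3](oK 0) /ind -(memJ_conjg (K 1) a) KJ -sum_ind_same.
  by apply: eq_bigr => l _; congr ind; rewrite conjgE !mulgA.
have -> : (\sum_(l in K 0) ind (K 0) (a^-1 * (a * (l * z)))%g = 3 * ind (K 0) z)%R.
  rewrite -[3](oK 0) -sum_ind_same.
  by apply: eq_bigr => l _; rewrite mulKg.
have -> : (\sum_(l in K 0) ind (K 0) (a * (l * z) * a)%g = ind E (z * a ^+ 2)%g)%R.
  have -> : ind E (z * a ^+ 2)%g = ind E ((z * a ^+ 2) ^ a^-1)%g by rewrite /ind EJ.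
  rewrite -(KK 0).2 -(sum_ind_TI _ (KK 0).1) -(KJV 0) -sumJ.
  by apply: eq_bigr => l _; congr ind; rewrite !conjgE expgS expg1 invgK !mulgA mulgKV mulgK.
case: (eqVneq z 1) => [->|z1].
  by rewrite /w2 /ind !group1; ring.
have -> : ind 1%g z = 0%R by rewrite /ind inE (negPf z1).
case: (boolP (z \in E)) => Ez.
  have -> : ind E z = 1%R by rewrite /ind Ez.
  by rewrite -(E_cover Ez z1) /w2; ring.
have nE (H : {group gT}) : H \subset E -> ind H z = 0%R.
  by move=> sHE; rewrite /ind (contraNF (subsetP sHE z)).
by rewrite !(nE _ (KE _)) (nE _ CE) (nE _ (subxx _)) /w2; ring.
Qed.

(** * The S-ring for [n >= 4] *)

(** Invariance under E comes from [w]. Inversion turns the product f w into w f, which is the same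
    because w(xy) = w(yx). *)
Let conv_unif f w : (forall x, f x^-1 = f x) -> unif w -> unif (conv f w).
Proof.
move=> fV uw; have [wE wV] := uw; split=> [z u Eu|z].
  by apply: eq_bigr => x _; rewrite mulgA wE.
rewrite conv_sym // /conv (reindex_inj invg_inj) (reindex_inj (mulIg z^-1)) /=.
apply: eq_bigr => x _; rewrite mulrC invgK mulgKV invMg invgK; congr (_ * _)%R.
by rewrite unif_comm.
Qed.

Let notE_a : a \notin E.
Proof.
by rewrite -[a]expg1 a_E; apply/negP=> /(dvdn_trans N3).
Qed.

Let XE x : x \in X -> x \notin E.
Proof.
rewrite inE; apply: contraL => Ex; rewrite negb_or; apply/andP; split.
  apply: contra notE_a => /(subsetP (KE 0)).
  by rewrite groupMr // groupV.
by apply: contra notE_a => /(subsetP (KE 0)); rewrite groupMl.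
Qed.

Let XZ x : x \in X -> x \notin Z.
Proof.
move=> Xx; apply/negP=> Zx; move: Xx; rewrite inE.
suff nK y : y \in Z -> y * a \notin K 0.
  rewrite (negPf (nK _ Zx)) orbF -groupV invMg invgK.
  by apply/negP/nK; rewrite groupV.
case/cycleP=> k ->; apply/negP=> /(subsetP (KE 0)).
rewrite -expgM -expgSr a_E => /(dvdn_trans N3).
by rewrite -(addn1 (3 * k)%N) dvdn_addr ?dvdn_mulr.
Qed.

Let unif_X w x : unif w -> x \in X -> w x = w a.
Proof.
move=> uw; have [wE wV] := uw; rewrite inE => /orP[] /(subsetP (KE 0)) Ex.
  by rewrite -(wE a _ Ex) mulKVg.
by rewrite -(mulgK a x) (unif_l _ uw Ex) wV.
Qed.

Let unif1 : unif (fun=> 1%R). Proof. by []. Qed.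

Let unifM w w' : unif w -> unif w' -> unif (fun x => w x * w' x)%R.
Proof. by case=> wE wV [wE' wV']; split=> x *; rewrite ?wE ?wE' ?wV ?wV'. Qed.

(** A spanning family, not a basis: products are checked generator by generator, without listing the
    basic sets. *)
Inductive gen : (gT -> int) -> Prop :=
| gen_1 : gen (ind 1%g)
| gen_K : gen (ind (K 2))
| gen_X : gen (ind X)
| gen_Z t : unif t -> gen (fun x => ind Z x * t x)%R
| gen_U w : unif w -> gen w.

Let gen_sym f : gen f -> forall x, f x^-1 = f x.
Proof.
case=> [|||t [_ tV]|w [_ wV]] x; rewrite ?tV ?wV //.
- by rewrite /ind !inE invg_eq1.
- by rewrite /ind groupV.
- by rewrite /ind X_sym.
- by rewrite /ind groupV.
Qed.

Let span_sym f : Zspan gen f -> forall x, f x^-1 = f x.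
Proof.
elim=> {f} [f /gen_sym //|f g _ fV _ gV|k f _ fV|f g _ fV fg] x.
- by rewrite fV gV.
- by rewrite fV.
- by rewrite -!fg.
Qed.

(** All generators are fixed by inversion, so only one order of each product has to be computed. *)
Let span_convC f g : gen f -> gen g ->
  Zspan gen (conv f g) -> Zspan gen (conv g f).
Proof.
move=> /gen_sym fV /gen_sym gV sfg; apply: Zspan_ext (sfg) _ => x.
by rewrite -(conv_sym fV gV) (span_sym sfg).
Qed.

Let prod_KZ : K 2 * Z = E * Z.
Proof.
rewrite -(CK 2).2 (centC (_ : C \subset 'C(K 2))).
  have sCZ : C \subset Z by apply/subsetP=> z; apply: ZC.
  by rewrite -mulgA (mulSGid sCZ).
exact: sub_abelian_cent2 abE CE (KE 2).
Qed.

Let unif_EZ : unif (ind (E * Z)).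
Proof.
have -> : E * Z = (E <*> Z)%G :> {set gT}.
  apply/esym/norm_joinEr; exact: subset_trans (subsetT _) (normal_norm normE).
split=> [x u Eu|x]; last by rewrite /ind groupV.
by rewrite /ind groupMr //; apply: (subsetP (joing_subl _ _)).
Qed.

(** K_2 meets Z trivially because Z and E intersect in C; hence K_2 Z = EZ without multiplicity, and
    [t] factors out since K_2 lies in E. *)
Let conv_KZ t : unif t ->
  conv (ind (K 2)) (fun x => ind Z x * t x)%R =1 (fun x => ind (E * Z)%g x * t x)%R.
Proof.
move=> ut x; rewrite conv_indg -prod_KZ.
have tiKZ : K 2 :&: Z = 1.
  apply/trivgP/subsetP=> z /setIP[Kz Zz].
  by rewrite -(CK 2).1 inE Kz Z_E // (subsetP (KE 2)).
rewrite -(sum_ind_TI _ tiKZ) big_distrl /=; apply: eq_bigr => l Kl.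
by rewrite (unif_l _ ut) // (subsetP (KE 2)).
Qed.

Let conv_ZZ t t' : unif t -> unif t' ->
  exists2 w, unif w & conv (fun x => ind Z x * t x)%R (fun x => ind Z x * t' x)%R
    =1 (fun x => ind Z x * w x)%R.
Proof.
move=> [tE tV] ut'; have [tE' tV'] := ut'.
(* For z in Z, z^-1 x lies in Z exactly when x does, so the second indicator of [Z] can be pulled
   out of the sum. *)
exists (conv (fun x => ind Z x * t x)%R t').
  by apply: conv_unif => // x; rewrite tV /ind groupV.
move=> x; rewrite /conv big_distrr /=; apply: eq_bigr => z _.
case: (boolP (z \in Z)) => Zz.
  rewrite (_ : ind Z (z^-1 * x)%g = ind Z x); first by ring.
  by rewrite /ind groupMl ?groupV.
by rewrite (_ : ind Z z = 0%R) ?mul0r ?mulr0 // /ind (negPf Zz).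
Qed.

(* As [t] is [C]-invariant, three times this convolution is [t * (C * X)]. *)
Let conv_ZX t : unif t -> unif (conv (fun x => ind Z x * t x)%R (ind X)).
Proof.
move=> ut; have [tE tV] := ut; set f := fun x => _.
have fV x : f x^-1 = f x by rewrite /f tV /ind groupV.
have [hE hV] := conv_unif fV (unif_E a).
suff h3 y : conv f w1 y = (3 * conv f (ind X) y)%R.
  by split=> [x u Eu|x]; apply: (mulfI (_ : 3%:R != 0 :> int)%R) => //;
    rewrite -!h3 ?hE ?hV.
rewrite /conv; under eq_bigr => z _ do rewrite -conv_CX conv_indg big_distrr /=.
rewrite exchange_big /= -[3]oc mulr_natl -sumr_const; apply: eq_bigr => l Cl.
rewrite (reindex_inj (mulIg l)) /=; apply: eq_bigr => z _.
have Zl := ZC Cl; rewrite /f tE ?(subsetP CE) // /ind (groupMr z Zl).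
by rewrite invMg -(mulgA l^-1) mulKVg.
Qed.

Let gen_conv f g : gen f -> gen g -> Zspan gen (conv f g).
Proof.
have U w : unif w -> Zspan gen w by move=> uw; apply/Zspan_gen/gen_U.
have sE : unif (ind E) by split=> [x u Eu|x]; rewrite /ind ?groupMr ?groupV.
have s1 : Zspan gen (ind 1%g) by apply/Zspan_gen/gen_1.
have sK : Zspan gen (ind (K 2)) by apply/Zspan_gen/gen_K.
(* C is the intersection of Z and E, hence an instance of [gen_Z] with the indicator of [E]. *)
have sC : Zspan gen (ind C).
  apply: Zspan_ext (Zspan_gen (gen_Z sE)) _ => x; rewrite /ind.
  case: (boolP (x \in C)) => [Cx|]; first by rewrite ZC // (subsetP CE) ?mulr1.
  case: (boolP (x \in Z)) => [Zx|_ _]; last by rewrite mul0r.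
  by case: (boolP (x \in E)) => [/(Z_E Zx) ->|]; rewrite ?mulr0.
have fU h w : gen h -> unif w -> Zspan gen (conv h w).
  by move=> /gen_sym hV uw; apply/U/conv_unif.
have uf w h : gen h -> unif w -> Zspan gen (conv w h).
  by move=> gh uw; apply: span_convC (gen_U uw) _ => //; apply: fU.
have f1 h : gen h -> Zspan gen (conv (ind 1%g) h).
  by move=> gh; apply: Zspan_ext (Zspan_gen gh) _ => x; rewrite conv1l.
have KX : Zspan gen (conv (ind (K 2)) (ind X)).
  by apply: Zspan_ext (U _ (unif_E a)) _ => x; rewrite conv_KX.
have KZ t : unif t -> Zspan gen (conv (ind (K 2)) (fun x => ind Z x * t x)%R).
  move=> ut; apply: Zspan_ext (U _ (unifM unif_EZ ut)) _ => x.
  by rewrite conv_KZ.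
have ZX t : unif t -> Zspan gen (conv (fun x => ind Z x * t x)%R (ind X)).
  by move=> ut; apply/U/conv_ZX.
move=> gf gg; case: (gf) (gg) => [|||t ut|w uw].
- exact: f1.
- case=> [|||t ut|w uw].
  + by apply: (span_convC gen_1 gen_K); apply/f1/gen_K.
  + apply: Zspan_ext (Zspan_scale 3%:R%R sK) _ => x.
    by rewrite conv_indg sum_ind_same oK.
  + exact: KX.
  + exact: KZ.
  + by apply: fU => //; apply: gen_K.
- case=> [|||t ut|w uw]; last by (apply: fU => //; apply: gen_X).
  + by apply: (span_convC gen_1 gen_X); apply/f1/gen_X.
  + exact: span_convC gen_K gen_X KX.
  + apply: Zspan_ext (Zspan_add (U _ (unif_E (a ^+ 2))) (Zspan_scale 3%:R%R
      (Zspan_add (U _ sE) (Zspan_add (Zspan_scale (-1)%R sC)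
        (Zspan_add (Zspan_scale (-1)%R sK) (Zspan_scale 3%:R%R s1)))))) _ => x.
    by rewrite conv_XX /w2; ring.
  + exact: span_convC (gen_Z ut) gen_X (ZX _ ut).
- case=> [|||t' ut'|w uw]; last by (apply: fU => //; apply: gen_Z).
  + by apply: (span_convC gen_1 (gen_Z ut)); apply/f1/gen_Z.
  + exact: span_convC gen_K (gen_Z ut) (KZ _ ut).
  + exact: ZX.
  + have [w uw eqw] := conv_ZZ ut ut'.
    by apply: Zspan_ext (Zspan_gen (gen_Z uw)) _ => x; rewrite eqw.
- by move=> gg'; apply: uf.
Qed.

(** Closure under pointwise products puts the indicator of a colour class in the span, as the
    product of the conditions on the coordinates of the colour. *)
Let gen_mul f g : gen f -> gen g -> Zspan gen (ptmul f g).
Proof.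
have mulC f' g' : Zspan gen (ptmul f' g') -> Zspan gen (ptmul g' f').
  by move/Zspan_ext; apply=> x; rewrite /ptmul mulrC.
have s0 : Zspan gen (fun=> 0%R).
  by apply: Zspan_ext (Zspan_scale 0%R (Zspan_gen gen_1)) _ => x; rewrite mul0r.
have f1 h : Zspan gen (ptmul (ind 1%g) h).
  apply: Zspan_ext (Zspan_scale (h 1) (Zspan_gen gen_1)) _ => x.
  by rewrite /ptmul /ind inE; case: eqP => [->|_]; rewrite ?mulr0 ?mul0r // mulrC.
have KX : Zspan gen (ptmul (ind (K 2)) (ind X)).
  apply: Zspan_ext s0 _ => x; rewrite /ptmul /ind; case: (boolP (x \in X)) => [Xx|_].
    by rewrite (contraNF (subsetP (KE 2) x)) ?XE ?mul0r.
  by rewrite mulr0.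
have KZ t : unif t -> Zspan gen (ptmul (ind (K 2)) (fun x => ind Z x * t x)%R).
  move=> ut; apply: Zspan_ext (f1 t) _ => x; rewrite /ptmul mulrA; congr (_ * _)%R.
  rewrite -(CK 2).1 /ind inE; case: (boolP (x \in K 2)) => [Kx|_]; last by rewrite andbF mul0r.
  rewrite andbT mul1r; suff -> : (x \in C) = (x \in Z) by [].
  by apply/idP/idP=> [/ZC //|Zx]; rewrite Z_E // (subsetP (KE 2)).
have Kw w : unif w -> Zspan gen (ptmul (ind (K 2)) w).
  move=> uw; apply: Zspan_ext (Zspan_scale (w 1) (Zspan_gen gen_K)) _ => x.
  rewrite /ptmul mulrC /ind; case: (boolP (x \in K 2)) => [Kx|_]; last by rewrite !mul0r.
  by rewrite -[x]mul1g uw.1 // (subsetP (KE 2)).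
have XZ0 t : Zspan gen (ptmul (ind X) (fun x => ind Z x * t x)%R).
  apply: Zspan_ext s0 _ => x; rewrite /ptmul /ind; case: (boolP (x \in X)) => [Xx|_].
    by rewrite (negPf (XZ Xx)) mul0r mulr0.
  by rewrite mul0r.
have Xw w : unif w -> Zspan gen (ptmul (ind X) w).
  move=> uw; apply: Zspan_ext (Zspan_scale (w a) (Zspan_gen gen_X)) _ => x.
  rewrite /ptmul mulrC /ind; case: (boolP (x \in X)) => [Xx|_]; last by rewrite !mul0r.
  by rewrite (unif_X uw).
have ii (A : {set gT}) : gen (ind A) -> Zspan gen (ptmul (ind A) (ind A)).
  move=> gA; apply: Zspan_ext (Zspan_gen gA) _ => x.
  by rewrite /ptmul /ind; case: (x \in A); rewrite ?mulr0 ?mulr1.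
have Zw t w : unif t -> unif w -> Zspan gen (ptmul (fun x => ind Z x * t x)%R w).
  move=> ut uw; apply: Zspan_ext (Zspan_gen (gen_Z (unifM ut uw))) _ => x.
  by rewrite /ptmul mulrA.
have Zt t t' : unif t -> unif t' ->
    Zspan gen (ptmul (fun x => ind Z x * t x)%R (fun x => ind Z x * t' x)%R).
  move=> ut ut'; apply: Zspan_ext (Zspan_gen (gen_Z (unifM ut ut'))) _ => x.
  rewrite /ptmul mulrACA; congr (_ * _)%R.
  by rewrite /ind; case: (x \in Z); rewrite ?mulr0 ?mulr1.
have ww w w' : unif w -> unif w' -> Zspan gen (ptmul w w').
  by move=> uw uw'; apply/Zspan_gen/gen_U/unifM.
by case=> [|||t ut|w uw]; case=> [|||t' ut'|w' uw'];
  auto using gen_1, gen_K, gen_X.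
Qed.

(** An element of G/E up to inversion: the [unif] functions are those that factor through
    [cosets]. *)
Let cosets x : {set {set gT}} := [set x *: E; x^-1 *: E].

Let cosetE x y : (y \in x *: E) = (x^-1 * y \in E). Proof. by rewrite mem_lcoset. Qed.

Let lcosetE x u : u \in E -> (x * u) *: E = x *: E.
Proof. by move=> Eu; rewrite lcosetM lcoset_id. Qed.

Let unif_cosets s : unif (fun x => (cosets x == s)%:R%R).
Proof.
split=> [x u Eu|x]; rewrite /cosets; last by rewrite invgK setUC.
by rewrite lcosetE // invMg (conjgC u^-1) lcosetE // EJ groupV.
Qed.

Let cosetsP x y : cosets x = cosets y -> y \in x *: E \/ y \in x^-1 *: E.
Proof.
move=> exy; have: y *: E \in cosets x by rewrite exy !inE eqxx.
by rewrite !inE => /orP[] /eqP <-; [left|right]; apply: lcoset_refl.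
Qed.

Definition color x := (cosets x, x \in [1 gT], x \in K 2, x \in Z, x \in X).

Lemma gen_color f : gen f -> forall x y, color x = color y -> f x = f y.
Proof.
move=> gf x y [/cosetsP exy e1 eK eZ eX].
have unif_xy w : unif w -> w x = w y.
  move=> uw; have [wE wV] := uw; case: exy; rewrite cosetE => Ey.
    by rewrite -(wE x _ Ey) mulKVg.
  by rewrite -wV -(wE x^-1 _ Ey) mulKVg.
by case: gf => [|||t /unif_xy <-|w /unif_xy //]; rewrite /ind ?e1 ?eK ?eZ ?eX.
Qed.

Lemma Sring_color : is_Sring (preim_partition color [set: gT]).
Proof.
apply: (@Sring_of_Zspan _ _ _ gen) => [|s|||x].
- exact: gen_color.
- case: s => [[[[s c1] cK] cZ] cX].
  have s1 : Zspan gen (fun=> 1%R) by apply/Zspan_gen/gen_U/unif1.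
  have sZ : Zspan gen (ind Z).
    apply: Zspan_ext (Zspan_gen (gen_Z unif1)) _ => x; exact: mulr1.
  have m := Zspan_ptmul gen_mul.
  have sf (A : {set gT}) e : Zspan gen (ind A) -> Zspan gen (fun y => ((y \in A) == e)%:R%R).
    exact: Zspan_flag.
  apply: Zspan_ext (m _ _ (m _ _ (m _ _ (m _ _ (Zspan_gen (gen_U (unif_cosets s)))
    (sf _ c1 (Zspan_gen gen_1))) (sf _ cK (Zspan_gen gen_K))) (sf _ cZ sZ))
    (sf _ cX (Zspan_gen gen_X))) _ => x.
  by rewrite /ptmul !xpair_eqE -!natrM !mulnb.
- exact: gen_conv.
- move=> x; rewrite /color !groupV X_sym; congr (_, _, _, _, _).
  by rewrite /cosets invgK setUC.
- by case=> _; rewrite group1 => /set1gP.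
Qed.

Let mem_eq (A : {set gT}) x y : x \in A -> x = y -> y \in A.
Proof. by move=> Ax <-. Qed.

(** * Non-schurity for n >= 4 *)

Let q := coset E.

Let qM x y : q (x * y) = q x * q y.
Proof. by apply: morphM; rewrite (subsetP (normal_norm normE)). Qed.

Let qV x : q x^-1 = (q x)^-1.
Proof. by apply: morphV; rewrite (subsetP (normal_norm normE)). Qed.

Let qE x : (x \in E) = (q x == 1).
Proof.
apply/idP/eqP=> [/coset_id //|]; apply: coset_idr.
by rewrite (subsetP (normal_norm normE)).
Qed.

Let qa1 : q a != 1. Proof. by rewrite -qE notE_a. Qed.

Let qa2 : q a * q a != 1.
Proof. by rewrite -qM -qE -expg2 a_E; apply/negP=> /(dvdn_trans N3). Qed.

Let K0_q x : x \in K 0 -> q x = 1.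
Proof. by move=> Kx; apply/eqP; rewrite -qE (subsetP (KE 0)). Qed.

Let X_qa x : x \in X -> q x = q a -> a^-1 * x \in K 0.
Proof.
rewrite inE => /orP[//|/K0_q]; rewrite qM => + qxa.
by rewrite qxa => /eqP; rewrite (negPf qa2).
Qed.

Let color_E x y : color x = color y -> (x \in E) = (y \in E).
Proof.
move=> exy; have sE : unif (ind E) by split=> [z u Eu|z]; rewrite /ind ?groupMr ?groupV.
by have := gen_color (gen_U sE) exy; rewrite /ind; case: (x \in E); case: (y \in E).
Qed.

Let b_K0 : b \in K 0. Proof. by rewrite /K mulg1 cycle_id. Qed.

Let c_notK0 : c \notin K 0.
Proof.
apply/negP=> Kc; have : c \in C :&: K 0 by rewrite inE cycle_id.
by rewrite (CK 0).1 => /set1gP c1; move: oc; rewrite c1 order1.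
Qed.

Lemma not_schurian_color : 9 %| N -> ~ schurian (preim_partition color [set: gT]).
Proof.
move=> N9 /schurian_color sch.
have colb : color b = color b^-1.
  rewrite /color !groupV X_sym; congr (_, _, _, _, _).
  by rewrite /cosets invgK setUC.
have [s [s1 sb sc]] := sch _ _ colb.
have sX u v : v * u^-1 \in X -> s v * (s u)^-1 \in X.
  by move=> Xvu; have [_ _ _ _ ->] := sc u v.
have sZ u v : v * u^-1 \in Z -> s v * (s u)^-1 \in Z.
  by move=> Zvu; have [_ _ _ -> _] := sc u v.
have sE u v : (s v * (s u)^-1 \in E) = (v * u^-1 \in E).
  by rewrite (color_E (sc u v)).
(* The neighbours of [1] and of [b] in [a * E] coincide, unlike those in [a^-1 * E]. *)
have sa : q (s a) = q a.
  have X1 : s a * (s 1)^-1 \in X by apply: sX; rewrite invg1 mulg1 inE mulVg group1.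
  have Xb : s a * (s b)^-1 \in X by apply: sX; rewrite inE mulKg groupV b_K0.
  move: X1 Xb; rewrite s1 sb invg1 invgK mulg1 !inE.
  case: (boolP (_ \in K 0)) => [/K0_q|_] /=.
    by rewrite qM qV => /eqP; rewrite -eq_mulVg1 => /eqP.
  have qb : q b = 1 by apply/K0_q.
  move=> Ksa; have qsa : q (s a) = (q a)^-1.
    by apply/eqP; rewrite -(inj_eq (mulIg (q a))) mulVg -qM; apply/eqP/K0_q.
  case/orP=> [/K0_q|].
    rewrite !qM qb qsa qV mulg1 => /eqP.
    by rewrite -invMg -(inj_eq invg_inj) invgK invg1 (negPf qa2).
  rewrite -mulgA (conjgC b) mulgA groupMl // bJa groupMl // groupV.
  by rewrite (negPf c_notK0).
(* Two consecutive powers are carried along. An X-neighbour of s(a^(i+1)) lies one coset forward or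
   back; going back would place s(a^(i+2)) in the coset of s(a^i), which [sE] excludes because a^2
   is not in E. *)
have sblock i : q (s (a ^+ i)) = q (a ^+ i).
  have [//] : q (s (a ^+ i)) = q (a ^+ i) /\ q (s (a ^+ i.+1)) = q (a ^+ i.+1).
  elim: i => [|i [IH0 IH1]]; first by rewrite s1 !expg1 sa.
  split=> //.
  have := sX (a ^+ i.+1) (a ^+ i.+2); rewrite (expgS a i.+1) mulgK.
  rewrite -(expgS a i.+1) inE mulVg group1 => /(_ isT); rewrite inE => /orP[] /K0_q e.
    rewrite !qM !qV IH1 in e; move/eqP: e; rewrite mulgA -eq_mulgV1 => /eqP e.
    have -> : a ^+ i.+2 = a * a ^+ i.+1 by rewrite -expgS.
    by rewrite [RHS]qM -e mulKVg -expgS.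
  have q1 : q (a ^+ i.+1) = q a * q (a ^+ i) by rewrite expgS qM.
  rewrite !qM !qV IH1 q1 invMg mulgA mulgKV -IH0 in e.
  move/eqP: e; rewrite -eq_mulgV1 => /eqP e.
  have : s (a ^+ i.+2) * (s (a ^+ i))^-1 \in E by rewrite qE qM qV e mulgV.
  rewrite sE (expgS a i.+1) (expgS a i) mulgA mulgK -expg2 a_E => N2.
  by have := dvdn_trans N3 N2.
have sq u : q (s u) = q u.
  have [i [v Ev ->]] := decE u.
  have : a ^+ i * v * (a ^+ i)^-1 \in E.
    by rewrite qE !qM qV (eqP (_ : q v == 1)) -?qE // mulg1 mulgV.
  rewrite -sE qE qM qV -eq_mulgV1 => /eqP ->; rewrite sblock qM.
  by move: Ev; rewrite qE => /eqP->; rewrite mulg1.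
(* As every coset of E is fixed, the X-arcs leading one coset forward are preserved separately from
   those leading back. *)
have sK u v : a^-1 * (v * u^-1) \in K 0 -> a^-1 * (s v * (s u)^-1) \in K 0.
  move=> Kvu; apply: X_qa; first by apply: sX; rewrite inE Kvu.
  rewrite qM qV !sq -qV -qM; apply: (mulgI (q a)^-1).
  by rewrite mulVg -qV -qM; apply: K0_q.
pose x i := s (a ^+ i) * (a ^+ i)^-1.
have Ex i : x i \in E by rewrite qE /x qM qV sblock mulgV.
(* This is the image of the arc from a^i to a^(i+1), written with the displacements [x]. *)
have xK i : x i.+1 ^ a * (x i)^-1 \in K 0.
  have := sK (a ^+ i) (a ^+ i.+1); rewrite (expgS a i) mulgK mulVg group1.
  move/(_ isT); move/mem_eq; apply; rewrite /x conjgE invMg invgK.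
  rewrite [(a ^+ i.+1)^-1](_ : _ = (a ^+ i)^-1 * a^-1); last by rewrite expgS invMg.
  by rewrite -(expgS a i) !mulgA !mulgKV.
(* By [xK], consecutive [e i] agree modulo [K 0], which meets [C] trivially. *)
pose e i := x (i + 3)%N * (x i)^-1.
have eC i : e i \in C.
  apply: Z_E; last by rewrite groupM ?groupV.
  have Za3 : a ^+ 3 \in Z by apply: cycle_id.
  have Zs : s (a ^+ (i + 3)) * (s (a ^+ i))^-1 \in Z.
    by apply: sZ; rewrite addnC expgD mulgK.
  have -> : e i = (a ^+ 3)^-1 * (s (a ^+ (i + 3)) * (s (a ^+ i))^-1).
    rewrite mulgA (cent_z _ (groupVr Za3)) /e /x.
    have -> : (a ^+ (i + 3))^-1 = (a ^+ 3)^-1 * (a ^+ i)^-1 by rewrite expgD invMg.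
    by rewrite (invMg (s (a ^+ i))) invgK !mulgA mulgKV.
  by rewrite groupM ?groupV.
have abE_C u v : u \in E -> v \in E -> u * v = v * u.
  by move=> Eu Ev; apply: (centsP abE) Eu _ Ev.
have swap A B U V : B \in E -> U \in E -> V \in E ->
    A * U^-1 * (B * V^-1)^-1 = A * B^-1 * (U * V^-1)^-1.
  move=> EB EU EV; rewrite !invMg !invgK -!mulgA; congr (_ * _).
  by rewrite abE_C ?groupM ?groupV // (abE_C V) ?groupV // !mulgA.
have eS i : e i.+1 = e i.
  apply/eqP; rewrite eq_mulgV1; apply/eqP/set1gP; rewrite -(CK 0).1 inE.
  rewrite groupM ?groupV ?eC //=.
  have := groupM (xK (i + 3)%N) (groupVr (xK i)); move/mem_eq; apply.
  by rewrite swap ?EJ // -conjVg -conjMg -addSn (ZJ a (ZC (eC i.+1))).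
have x3 k : x (3 * k)%N = e 0 ^+ k.
  have e0 m : e m = e 0 by elim: m => // m <-.
  elim: k => [|k IH]; first by rewrite /x muln0 s1 invg1 mulg1.
  by rewrite mulnS addnC expgS -IH -(e0 (3 * k)%N) mulgKV.
(* With N = 9k, x_N = (e_0)^(3k) = 1, since e_0 lies in C, of order 3. *)
have scc : s c = c.
  have : x N = 1.
    case/dvdnP: N9 => k ->; rewrite (_ : k * 9 = 3 * (3 * k))%N; last by ring.
    by rewrite x3 expgM -oc (expg_cardG (eC 0)) expg1n.
  by rewrite /x -/c => /eqP; rewrite -eq_mulgV1 => /eqP.
(* c and c b share the forward neighbour a c, while 1 and c b share the backward neighbour a^-1.
   Together with w b in C, the first forces w = b^-1 c; then w^a = b^-1 c^2 is outside K_0, against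
   the second. *)
pose w := s (c * b).
have Kwc : w * c^-1 \in K 0.
  have := sK c (a * c); rewrite scc mulgK mulVg group1 => /(_ isT) k1.
  have := sK (c * b) (a * c); rewrite (_ : a^-1 * _ = b^-1); last first.
    by rewrite -mulgA mulKg (cent_c b) invMg mulKVg.
  rewrite groupV b_K0 -/w => /(_ isT) k2.
  have := groupM (groupVr k2) k1; move/mem_eq; apply.
  by rewrite !invMg !invgK -!mulgA mulKVg mulKg.
have cJ x0 : c ^ x0 = c by apply/ZJ/ZC/cycle_id.
have Kwa : w ^ a \in K 0.
  have := sK a^-1 1; rewrite mul1g invgK mulVg group1 s1 mul1g => /(_ isT) k1.
  have := sK a^-1 (c * b); rewrite (_ : a^-1 * _ = b); last first.
    by rewrite invgK -conjgE conjMg bJa cJ mulgA (cent_c b) mulgK.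
  rewrite b_K0 -/w => /(_ isT) k2.
  have := groupM k2 (groupVr k1); move/mem_eq; apply.
  by rewrite invMg !invgK conjgE !mulgA mulgKV.
have Cwb : w * b \in C.
  apply: Z_E; last by rewrite qE qM sq -qM -qE !groupM ?bE ?cE.
  by have := sZ b (c * b); rewrite mulgK sb invgK; apply; apply/ZC/cycle_id.
have /eqP : w * c^-1 * b = 1.
  apply/set1gP; rewrite -(CK 0).1 inE (groupM Kwc b_K0) andbT.
  rewrite -mulgA (cent_z b (ZC (groupVr (cycle_id c)))) mulgA groupM //.
  by rewrite groupV cycle_id.
rewrite -(mulVg b) (inj_eq (mulIg b)) -(inj_eq (mulIg c)) mulgKV => /eqP ew.
move: Kwa; rewrite ew conjMg conjVg bJa invMg invgK cJ (cent_c b^-1) -mulgA.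
rewrite groupMl ?groupV // (_ : c * c = c^-1) ?groupV ?(negPf c_notK0) //.
by apply/eqP; rewrite eq_sym eq_invg_mul -expg2 -expgS c3.
Qed.

(** * The S-ring for [n = 3] *)

Section Order27.

Hypothesis N_3 : N = 3.

Let D0 := (C :|: X).

Let qa3 : q a * q a = (q a)^-1.
Proof.
apply/eqP; rewrite eq_sym eq_invg_mul -!qM -qE.
by rewrite -[_ * _]/(a ^+ 3) a_E N_3.
Qed.

Let q_cases z : [\/ q z = 1, q z = q a | q z = (q a)^-1].
Proof.
have [i [u + ->]] := decE z; rewrite qE qM => /eqP ->; rewrite mulg1.
elim: i => [|i]; first by constructor 1; rewrite -[a ^+ 0]/1; apply/eqP; rewrite -qE.
have -> : q (a ^+ i.+1) = q a * q (a ^+ i) by rewrite expgS qM.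
by case=> ->; [constructor 2; rewrite mulg1|constructor 3|constructor 1; rewrite mulgV].
Qed.

Let qaV : ((q a)^-1 == 1) = false /\ (q a == (q a)^-1) = false.
Proof.
split; first by rewrite -(inj_eq invg_inj) invgK invg1 (negPf qa1).
by rewrite eq_sym eq_invg_mul (negPf qa2).
Qed.

Let q_l g z : (g^-1 * z \in E) = (q z == q g).
Proof. by rewrite qE qM qV -[RHS](inj_eq (mulgI (q g)^-1)) mulVg. Qed.

Let q_r g z : (z * g \in E) = (q z == (q g)^-1).
Proof. by rewrite qE qM -[RHS](inj_eq (mulIg (q g))) mulVg. Qed.

Let total z : (ind E z + w1 z = 1)%R.
Proof.
rewrite /w1 /ind q_l q_r qE; have [qaV1 qaV2] := qaV.
case: (q_cases z) => ->; rewrite ?eqxx ?qaV1 ?qaV2 ?(eq_sym _ (q a)) ?qaV2 ?(eq_sym 1) ?qaV1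
  ?(negPf qa1) ?addr0 ?add0r //.
Qed.

Let w2_w1 z : w2 z = w1 z.
Proof.
rewrite /w1 /w2 /ind !q_l !q_r.
have -> : q (a ^+ 2) = (q a)^-1 by rewrite expg2 qM qa3.
by rewrite invgK addrC.
Qed.

Let ind_D x : ind D0 x = (ind C x + ind X x)%R.
Proof.
rewrite /ind inE; case: (boolP (x \in C)) => [Cx|_]; last by rewrite add0r.
by rewrite (contraTF (@XE x)) ?(subsetP CE) ?addr0.
Qed.

(** K_2 C = E and K_2 X = a E + a^-1 E add up to G; thus [D0] is a transversal of K_2. *)
Let conv_KD : conv (ind (K 2)) (ind D0) =1 fun=> 1%R.
Proof.
move=> z; rewrite (eq_conv (fun=> erefl) ind_D) convDr conv_KX -(total z).
congr (_ + _)%R; have [tiCK prodCK] := CK 2.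
rewrite conv_indg sum_ind_TI; last by rewrite setIC.
by rewrite -prodCK (centC (sub_abelian_cent2 abE CE (KE 2))).
Qed.

Let D_sym x : (x^-1 \in D0) = (x \in D0).
Proof. by rewrite !in_setU X_sym groupV. Qed.

(** As [D0] is closed under inversion, this says that it is a relative difference set with
    parameters (9, 3, 9, 3) and forbidden subgroup K_2. *)
Let conv_DD z :
  conv (ind D0) (ind D0) z = (3 - 3 * ind (K 2) z + 9 * ind 1%g z)%R.
Proof.
have CX := conv_CX; have XC y : conv (ind X) (ind C) y = w1 y.
  have CV x : ind C x^-1 = ind C x by rewrite /ind groupV.
  have XV x : ind X x^-1 = ind X x by rewrite /ind X_sym.
  by rewrite -(conv_sym CV XV) conv_CX; apply: (unif_E a).2.
rewrite (eq_conv ind_D ind_D) convDl !convDr CX XC conv_XX w2_w1 conv_indg.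
rewrite sum_ind_same [#|C|]oc.
have -> : w1 z = (1 - ind E z)%R by rewrite -(total z); ring.
ring.
Qed.

Inductive gen3 : (gT -> int) -> Prop :=
| gen3_1 : gen3 (ind 1%g)
| gen3_K : gen3 (ind (K 2))
| gen3_D : gen3 (ind D0)
| gen3_T : gen3 (fun=> 1%R).

Let gen3_conv f g : gen3 f -> gen3 g -> Zspan gen3 (conv f g).
Proof.
have s1 := Zspan_gen gen3_1; have sK := Zspan_gen gen3_K.
have sD := Zspan_gen gen3_D; have sT := Zspan_gen gen3_T.
have f1 h : gen3 h -> Zspan gen3 (conv (ind 1%g) h).
  by move=> /Zspan_gen sh; apply: Zspan_ext sh _ => x; rewrite conv1l.
have g1 h : gen3 h -> Zspan gen3 (conv h (ind 1%g)).
  by move=> /Zspan_gen sh; apply: Zspan_ext sh _ => x; rewrite conv1r.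
have fT h : Zspan gen3 (conv h (fun=> 1%R)).
  by apply: Zspan_ext (Zspan_scale (\sum_x h x)%R sT) _ => x; rewrite conv_cst mulr1.
have gT' h : Zspan gen3 (conv (fun=> 1%R) h).
  by apply: Zspan_ext (Zspan_scale (\sum_x h x)%R sT) _ => x; rewrite conv_cstl mulr1.
case=> [|||]; case=> [|||];
  try by [apply: f1; constructor|apply: g1; constructor|apply: fT|apply: gT'].
- apply: Zspan_ext (Zspan_scale 3%:R%R sK) _ => x.
  by rewrite conv_indg sum_ind_same oK.
- by apply: Zspan_ext sT _ => x; rewrite conv_KD.
- apply: Zspan_ext sT _ => x; rewrite -[x in RHS]invgK conv_sym ?conv_KD // => y.
    by rewrite /ind D_sym.
  by rewrite /ind groupV.
- apply: Zspan_ext (Zspan_add (Zspan_scale 3%:R%R sT) (Zspan_add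
    (Zspan_scale (- 3%:R)%R sK) (Zspan_scale 9%:R%R s1))) _ => x.
  by rewrite conv_DD; ring.
Qed.

Let D_E x : x \in D0 -> x \in E -> x \in C.
Proof. by rewrite inE => /orP[//|/XE /negPf ->]. Qed.

Let K_D : K 2 :&: D0 = 1.
Proof.
apply/eqP; rewrite eqEsubset sub1set !inE !group1 /= andbT; apply/subsetP=> x.
case/setIP=> Kx Dx; rewrite -(CK 2).1 inE Kx andbT.
by apply: D_E; rewrite ?(subsetP (KE 2)).
Qed.

Let gen3_mul f g : gen3 f -> gen3 g -> Zspan gen3 (ptmul f g).
Proof.
have s1 := Zspan_gen gen3_1; have sK := Zspan_gen gen3_K.
have sD := Zspan_gen gen3_D; have sT := Zspan_gen gen3_T.
have fT h : Zspan gen3 h -> Zspan gen3 (ptmul h (fun=> 1%R)).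
  by move=> sh; apply: Zspan_ext sh _ => x; rewrite /ptmul mulr1.
have gT' h : Zspan gen3 h -> Zspan gen3 (ptmul (fun=> 1%R) h).
  by move=> sh; apply: Zspan_ext sh _ => x; rewrite /ptmul mul1r.
have ii (A B A' : {set gT}) : Zspan gen3 (ind A') -> A :&: B = A' ->
    Zspan gen3 (ptmul (ind A) (ind B)).
  by move=> sA eAB; apply: Zspan_ext sA _ => x; rewrite ptmul_ind eAB.
have D1 : [1 gT] \subset D0 by apply/subsetP=> _ /set1gP ->; rewrite inE group1.
have K1 : [1 gT] \subset K 2 by apply: sub1G.
case=> [|||]; case=> [|||]; try by [apply: fT|apply: gT'].
- exact: ii s1 (setIid _).
- exact: ii s1 (setIidPl K1).
- exact: ii s1 (setIidPl D1).
- exact: ii s1 (setIidPr K1).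
- exact: ii sK (setIid _).
- exact: ii s1 K_D.
- exact: ii s1 (setIidPr D1).
- by apply: ii s1 _; rewrite setIC K_D.
- exact: ii sD (setIid _).
Qed.

Definition color3 x := (x \in [1 gT], x \in K 2, x \in D0).

Lemma Sring_color3 : is_Sring (preim_partition color3 [set: gT]).
Proof.
apply: (@Sring_of_Zspan _ _ _ gen3) => [f gf x y|s|||x].
- by case: gf; rewrite /ind; case=> e1 e2 e3; rewrite ?e1 ?e2 ?e3.
- case: s => [[c1 cK] cD]; have m := Zspan_ptmul gen3_mul.
  have sT := Zspan_gen gen3_T.
  apply: Zspan_ext (m _ _ (m _ _ (Zspan_flag c1 sT (Zspan_gen gen3_1))
    (Zspan_flag cK sT (Zspan_gen gen3_K))) (Zspan_flag cD sT (Zspan_gen gen3_D))) _ => x.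
  by rewrite /ptmul !xpair_eqE -!natrM !mulnb.
- exact: gen3_conv.
- by move=> x; rewrite /color3 !groupV D_sym.
- by case; rewrite group1 => /set1gP.
Qed.

(* Coordinates on [E]; exponents only matter modulo 3, so inversion is doubling. *)
Let e i j := b ^+ i * c ^+ j.

Let eM i j k l : e i j * e k l = e (i + k) (j + l).
Proof. by rewrite /e !expgD -!mulgA; congr (_ * _); rewrite !mulgA (commuteXl j). Qed.

Let eV i j : (e i j)^-1 = e (2 * i) (2 * j).
Proof.
apply/eqP; rewrite eq_invg_mul eM -!mulSn /e (expgM b 3) (expgM c 3) b3 c3.
by rewrite !expg1n mulg1.
Qed.

Let cV : c^-1 = c ^+ 2. Proof. by apply/eqP; rewrite eq_invg_mul -expgS c3. Qed.

Let eJ i j : e i j ^ a = e i (j + 2 * i).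
Proof.
have cJ : c ^ a = c by apply/ZJ/ZC/cycle_id.
rewrite /e conjMg (conjXg b) (conjXg c) bJa cJ expgMn; last first.
  by apply/commute_sym/cent_z/ZC; rewrite groupV cycle_id.
by rewrite cV -mulgA; congr (_ * _); rewrite -expgM -expgD addnC.
Qed.

Let eC i j : (e i j \in C) = (3 %| i).
Proof.
rewrite groupMr ?mem_cycle // -ob order_dvdn; apply/idP/eqP=> [Cb|->]; last exact: group1.
by apply/set1gP; rewrite -(CK 0).1 inE Cb groupX.
Qed.

Let eK i j : (e i j \in K 0) = (3 %| j).
Proof.
rewrite groupMl; last by apply: groupX b_K0.
rewrite -[X in X %| _]oc order_dvdn; apply/idP/eqP=> [Kc|->]; last exact: group1.
by apply/set1gP; rewrite -(CK 0).1 inE Kc mem_cycle.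
Qed.

Let K2_e x : x \in K 2 -> exists k, x = e k (2 * k).
Proof.
case/cycleP=> k ->; exists k; rewrite /e expgM expgMn //.
exact/commute_sym/commuteXl.
Qed.

Let D_qa x : x \in D0 -> q x = q a -> a^-1 * x \in K 0.
Proof.
rewrite inE => /orP[Cx|/X_qa]; last exact.
by move: (subsetP CE _ Cx); rewrite qE => /eqP-> /eqP; rewrite eq_sym (negPf qa1).
Qed.

Let D_qaV x : x \in D0 -> q x = (q a)^-1 -> x * a \in K 0.
Proof.
move=> Dx qx; have := @D_qa x^-1; rewrite D_sym qV qx invgK => /(_ Dx erefl).
by rewrite -groupV invMg !invgK.
Qed.

(** The triangle 1, c, c^2 of [D0]-neighbours and its left translate by a generator of K_2 are both
    followed through s; the exponents of the images are incompatible modulo 3. *)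
Lemma not_schurian_color3 : ~ schurian (preim_partition color3 [set: gT]).
Proof.
move=> /schurian_color sch.
have a_D : a \in D0 by rewrite !inE mulVg group1 orbT.
have notK2 x : x \notin E -> (x \in K 2) = false.
  by move=> nEx; apply: contraNF nEx => /(subsetP (KE 2)).
have not1 x : x \notin E -> (x \in [1 gT]) = false.
  by move=> nEx; apply: contraNF nEx => /set1gP ->; apply: group1.
have cNK : (c \in K 2) = false.
  apply/negbTE/negP=> Kc; have : c \in C :&: K 2 by rewrite inE cycle_id.
  by rewrite (CK 2).1 => /set1gP c1; move: oc; rewrite c1 order1.
have C_D y : y \in C -> y \in D0 by rewrite inE => ->.
have c_D : c \in D0 by apply/C_D/cycle_id.
have colca : color3 c = color3 a.
  rewrite /color3 a_D (notK2 a) ?(not1 a) ?notE_a // cNK c_D; congr (_, _, _).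
  by apply/negbTE/negP=> /set1gP c1; move: oc; rewrite c1 order1.
have [s [s1 sc colS]] := sch _ _ colca.
have sK u v : v * u^-1 \in K 2 -> s v * (s u)^-1 \in K 2.
  by move=> Kvu; have [_ -> _] := colS u v.
have sD u v : v * u^-1 \in D0 -> s v * (s u)^-1 \in D0.
  by move=> Dvu; have [_ _ ->] := colS u v.
have qc y : y \in E -> q y = 1 by rewrite qE => /eqP.
have Kl : b * c ^+ 2 \in K 2 by apply: cycle_id.
pose l := b * c ^+ 2.
have [d sl] : exists d, s l = e d (2 * d).
  by apply: K2_e; have := sK 1 l; rewrite s1 invg1 !mulg1; apply.
have nd : ~~ (3 %| d).
  apply/negP=> d3; have : s l = s 1.
    rewrite s1 sl; apply/set1gP; rewrite -(CK 0).1 inE eC eK d3.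
    exact: dvdn_mull.
  by move/perm_inj => l1; have := notCb 2; rewrite -/l l1 group1.
have [k sy] : exists k, s (l * c) = e k (2 * k) * a.
  have Ky : s (l * c) * (s c)^-1 \in K 2 by apply: sK; rewrite mulgK.
  by have [k ek] := K2_e Ky; exists k; rewrite -ek sc mulgKV.
have Ee i j : e i j \in E by apply: groupM (groupX _ bE) (groupX _ cE).
have Za3 : a ^+ 3 = c by rewrite /c N_3.
have aa : a^-1 * a^-1 = a * c^-1.
  apply: (mulgI a); apply: (mulIg c); rewrite mulKVg !mulgA mulgKV -Za3 (expgS a 2).
  by rewrite mulKg expg2.
have wordE (x y : gT) : a^-1 * (x * a * y^-1) = x ^ a * y^-1 by rewrite conjgE !mulgA.
have wordVE (x y : gT) : x * a^-1 * y^-1 * a = x * (y^-1) ^ a by rewrite conjgE !mulgA.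
have wordVV (x y : gT) : a^-1 * (x * a^-1 * (y * a)^-1) = x ^ a * c^-1 * y^-1.
  by rewrite conjgE invMg !mulgA -(mulgA (a^-1 * x)) aa !mulgA.
have qword (x y : gT) : x \in E -> y \in E -> q (x * a * y^-1) = q a.
  by move=> Ex Ey; rewrite !qM qV (qc x) // (qc y) // mul1g invg1 mulg1.
have qwordV (x y : gT) : x \in E -> y \in E -> q (x * a^-1 * y^-1) = (q a)^-1.
  by move=> Ex Ey; rewrite !qM !qV (qc x) // (qc y) // mul1g invg1 mulg1.
have qwordVV (x y : gT) : x \in E -> y \in E -> q (x * a^-1 * (y * a)^-1) = q a.
  by move=> Ex Ey; rewrite !qM !qV qM (qc x) // (qc y) // !mul1g -invMg qa3 invgK.
have kd : 3 %| k + d.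
  have : s (l * c) * (s l)^-1 \in D0.
    by apply: sD; rewrite (commute_sym (cent_c l)) mulgK.
  rewrite sy sl => /D_qa; rewrite wordE qword // eJ eV eM eK => /(_ erefl).
  have -> : (2 * k + 2 * k + 2 * (2 * d) = 4 * (k + d))%N by ring.
  by rewrite Gauss_dvdr.
(* s(c^2) is a [D0]-neighbour of both 1 and a. In E it would equal 1 = s(1), in a E it would equal a
   = s(c); so it lies in K_0 a^-1, and adjacency to a gives the congruence on j, using a^3 = c. *)
have [j j3 st] : exists2 j, 3 %| 2 * j + 2 & s (c ^+ 2) = e j 0 * a^-1.
  have Dt : s (c ^+ 2) \in D0.
    by have := sD 1 (c ^+ 2); rewrite s1 invg1 !mulg1; apply; apply/C_D/mem_cycle.
  have Dta : s (c ^+ 2) * a^-1 \in D0.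
    by have := sD c (c ^+ 2); rewrite sc expg2 mulgK; apply.
  case: (q_cases (s (c ^+ 2))) => qt.
  - have : s (c ^+ 2) \in C :&: K 0.
      rewrite inE D_E ?qE ?qt //=; have := D_qaV Dta; rewrite mulgKV; apply.
      by rewrite qM qV qt mul1g.
    rewrite (CK 0).1 => /set1gP; rewrite -s1 => /perm_inj /eqP.
    by rewrite -order_dvdn oc.
  - have Cta : s (c ^+ 2) * a^-1 \in C by apply: D_E; rewrite ?qE // qM qV qt mulgV.
    have : a^-1 * s (c ^+ 2) \in C :&: K 0.
      rewrite inE (D_qa Dt qt) andbT.
      by move: (Cta); rewrite -(ZJ a (ZC Cta)) conjgE mulgKV.
    rewrite (CK 0).1 => /set1gP /eqP; rewrite -eq_mulVg1 -sc => /eqP /perm_inj /eqP.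
    rewrite expg2 -{1}(mulg1 c) (inj_eq (mulgI c)) => /eqP c1.
    by move: oc; rewrite -c1 order1.
  - have /cycleP[j ej] := D_qaV Dt qt.
    have et : s (c ^+ 2) = e j 0 * a^-1.
      by rewrite -(mulgK a (s _)) ej /e !mulg1.
    have qta : q (s (c ^+ 2) * a^-1) = q a by rewrite qM qV qt -invMg qa3 invgK.
    exists j => //; have := D_qa Dta qta.
    have -> : s (c ^+ 2) * a^-1 = e j 0 * a^-1 * (e 0 0 * a)^-1.
      by rewrite et [e 0 0]mulg1 mul1g.
    rewrite wordVV; have -> : c^-1 = e 0 2 by rewrite cV /e mul1g.
    by rewrite eJ eV !eM eK addn0 add0n.
have [m st'] : exists m, s (l * c ^+ 2) = e (m + j) (2 * m) * a^-1.
  have Kt : s (l * c ^+ 2) * (s (c ^+ 2))^-1 \in K 2 by apply: sK; rewrite mulgK.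
  have [m em] := K2_e Kt; exists m.
  by rewrite -[in RHS](addn0 (2 * m)%N) -eM -(mulgA (e m (2 * m))) -st -em mulgKV.
have md : 3 %| m + d.
  have : s (l * c ^+ 2) * (s l)^-1 \in D0.
    apply: sD; rewrite (commute_sym (commuteXl 2 l)) mulgK C_D //; exact: mem_cycle.
  rewrite st' sl => /D_qaV; rewrite wordVE qwordV // eV eJ eM eK => /(_ erefl).
  have -> : (2 * m + (2 * (2 * d) + 2 * (2 * d)) = 2 * (m + d) + 3 * (2 * d))%N by ring.
  by rewrite (dvdn_addl _ (dvdn_mulr _ (dvdnn 3))) Gauss_dvdr.
have mk : 3 %| m + k.
  have : s (l * c ^+ 2) * (s (l * c))^-1 \in D0.
    apply: sD; rewrite expg2 mulgA (commute_sym (cent_c (l * c))) mulgK //.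
  rewrite st' sy => /D_qa; rewrite wordVV qwordVV // => /(_ erefl).
  have -> : c^-1 = e 0 2 by rewrite cV /e mul1g.
  rewrite eJ eV !eM eK.
  have -> : (2 * m + 2 * (m + j) + 2 + 2 * (2 * k) = 4 * (m + k) + (2 * j + 2))%N by ring.
  by rewrite (dvdn_addl _ j3) Gauss_dvdr.
(* The three edges of the translated triangle give k + d, m + d and m + k divisible by 3, hence also
   2d. *)
case/negP: nd; have := dvdn_add kd md.
have -> : (k + d + (m + d) = m + k + 2 * d)%N by ring.
by rewrite (dvdn_addr _ mk) Gauss_dvdr.
Qed.

End Order27.

End ModularGroup.

(** * From the presentation to generators of the modular group *)

Theorem theorem1 (n : nat) (hn : (3 <= n)%N) (gT : finGroupType)
  (hM : [set: gT] \isog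
          Grp (a : b : (a ^+ (3 ^ n.-1) = 1, b ^+ 3 = 1,
                        a ^ b = a ^+ (3 ^ (n - 2) + 1)))) :
  ~ Schur_group gT.
Proof.
rewrite addn1 subn2 in hM.
(* Both groups have the same presentation, so each is a homomorphic image of the other. *)
have isoM : [set: gT] \isog 'Mod_(3 ^ n).
  rewrite isogEhom; apply/andP; split.
    by rewrite (Grp_modular_group (isT : prime 3) hn); apply: (isoGrp_hom hM).
  by rewrite hM; apply: (isoGrp_hom (Grp_modular_group (isT : prime 3) hn)).
have [[a b] genM [ob aJb]] := generators_modular_group (isT : prime 3) hn isoM.
have [_ _ _ defG _] := extremal_generators_facts (isT : prime 3) genM.
have [_ _ oa /setDP[_ notAb]] := genM.
(* From here [n] is the former n minus 3, so 3^(n-2) becomes [3 ^ n.+1], and [n] = 0 is the group of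
   order 27. *)
case: n hn hM isoM genM aJb oa => [|[|[|n]]] // _ _ _ _ /= aJb oa.
have {}oa : #[a] = (3 * 3 ^ n.+1)%N by rewrite oa -expnS.
have N3 : 3 %| 3 ^ n.+1 by rewrite expnS dvdn_mulr.
have genab x : exists i j, x = a ^+ i * b ^+ j.
  have : x \in <[a]> * <[b]> by rewrite defG in_setT.
  by case/mulsgP=> _ _ /cycleP[i ->] /cycleP[j ->] ->; exists i, j.
case: n oa N3 aJb => [|n] oa N3 aJb sch.
  exact: (not_schurian_color3 oa ob N3 aJb notAb genab erefl
    (sch _ (Sring_color3 oa ob N3 aJb notAb genab erefl))).
apply: (not_schurian_color oa ob N3 aJb notAb genab _
    (sch _ (Sring_color oa ob N3 aJb notAb genab))).
by rewrite !expnS mulnA dvdn_mulr.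
Qed.
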